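(* Let $m\ge 2$ and $t\ge m$ be integers. Assume ${\rm DHL}^*(t;m)$ holds, and assume there exist a rational number $y$ and distinct positive integers $a_1,\ldots,a_t$ with \[\frac{\sigma(a_1)}{a_1}=\cdots=\frac{\sigma(a_t)}{a_t}=y.\] Then there exist positive integers $h_1<h_2<\cdots<h_m$ such that the set of positive integers $\ell$ for which the simultaneous equations \[\sigma(n+\ell h_1)=\sigma(n+\ell h_2)=\cdots=\sigma(n+\ell h_m)\] have infinitely many solutions $n\in\mathbb{N}$ has positive lower asymptotic density.
   Context: $\sigma(n)$ denotes the sum of the positive divisors of $n$. A collection of linear forms $(a_1n+b_1,\ldots,a_Kn+b_K)$ with integer coefficients is called admissible if $a_i>0$ for each $i$, the forms are pairwise distinct, and there is no prime $p$ dividing the product $(a_1n+b_1)\cdots(a_Kn+b_K)$ for every integer $n$. For positive integers $K\ge m$, the statement ${\rm DHL}^*(K;m)$ means: for every admissible collection of $K$ linear forms $(a_1n+b_1,\ldots,a_Kn+b_K)$ there exist distinct indices $i_1,\ldots,i_m\in\{1,\ldots,K\}$ such that there are infinitely many integers $r$ for which the $m$ numbers $a_{i_1}r+b_{i_1},\ldots,a_{i_m}r+b_{i_m}$ are simultaneously prime. *)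

(* Defs.v *)
From mathcomp Require Import all_boot all_order all_algebra.
From mathcomp Require Import all_classical all_reals all_analysis.

Set Implicit Arguments.
Unset Strict Implicit.
Unset Printing Implicit Defensive.

Import Order.TTheory GRing.Theory Num.Theory.
Local Open Scope classical_set_scope.
Local Open Scope ring_scope.

Definition sigma (n : nat) : nat := (\sum_(d <- divisors n) d)%N.

(* Negative integers are never prime. *)
Definition prime_int (z : int) : Prop := exists2 p : nat, prime p & z = p%:Z.

(* The i-th linear form is [a i * n + b i]. *)
Definition admissible (K : nat) (a b : 'I_K -> int) : Prop :=
  [/\ forall i, 0 < a i,
      injective (fun i => (a i, b i)) &
      ~ exists2 p : nat, prime p &
          forall n : int, (p%:Z %| \prod_(i < K) (a i * n + b i))%Z].

Definition DHLstar (K m : nat) : Prop :=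
  forall a b : 'I_K -> int, admissible a b ->
  exists s : 'I_m -> 'I_K, injective s /\
    infinite_set [set r : int |
      forall j : 'I_m, prime_int (a (s j) * r + b (s j))].

(* The liminf of #(A `&` {1, ..., N}) / N; the term N = 0 is 0 / 0 = 0 and does
   not affect it. *)
Definition lower_density (R : realType) (A : set nat) : \bar R :=
  limn_einf (fun N : nat =>
    ((\sum_(1 <= k < N.+1) (k \in A))%N%:R / N%:R)%:E).

(* Main.v *)
(** Let [A] be the product of the [a_i]. The forms [(A / a_i) r - 1] are
    admissible (look at [r = 0]), so for some [m] of the indices they are
    simultaneously prime, with values [p_i], for infinitely many [r]. For [l]
    coprime to [A] and [r] large, [sigma (l a_i p_i) =
    sigma l * sigma a_i * (p_i + 1) = sigma l * (sigma a_i / a_i) * A r]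
    does not depend on [i], while [l a_i p_i = l A r - l a_i]
    [= l A (r - 2) + l (2 A - a_i)]. So the [h_i] are the [2 A - a_i], sorted,
    for the selected indices; they do not depend on [l], and every [l]
    congruent to 1 modulo [A] works. *)
Require Import Defs.
From mathcomp Require Import all_boot all_order all_algebra.
From mathcomp Require Import all_classical all_reals all_analysis.
From mathcomp Require Import zify ring.

Set Implicit Arguments.
Unset Strict Implicit.
Unset Printing Implicit Defensive.

Import Order.TTheory GRing.Theory Num.Theory.
Local Open Scope classical_set_scope.
Local Open Scope ring_scope.

(** The products [d * e] with [d %| m] and [e %| n] list the divisors of [m * n] without repetition,
    since [d] is recovered as [gcdn (d * e) m]. *)
Lemma sigmaM (m n : nat) : (0 < m)%N -> (0 < n)%N -> coprime m n ->
  sigma (m * n)%N = (sigma m * sigma n)%N.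
Proof.
move=> m0 n0 cmn.
have mn0 : (0 < m * n)%N by rewrite muln_gt0 m0.
have memP (k d : nat) : (0 < k)%N -> (d \in divisors k) = (d %| k)%N.
  by move=> k0; rewrite dvdn_divisors.
have cop (d e : nat) : (d %| m)%N -> (e %| n)%N -> coprime d e.
  by move=> dm en; exact: coprime_dvdl dm (coprime_dvdr en cmn).
have e1 (d e : nat) : (d %| m)%N -> (e %| n)%N -> gcdn (d * e) m = d.
  move=> dm en; rewrite gcdnC mulnC Gauss_gcdr ?(gcdn_idPr dm)//.
  exact: coprime_dvdr en cmn.
have -> : sigma (m * n)%N =
    (\sum_(k <- [seq (d * e)%N | d <- divisors m, e <- divisors n]) k)%N.
  apply: perm_big; apply: uniq_perm; first exact: divisors_uniq.
    apply: allpairs_uniq; try exact: divisors_uniq.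
    move=> [d e] [d' e'] /allpairsP[[? ?] /= [+ + [-> ->]]].
    rewrite !memP// => dm en /allpairsP[[? ?] /= [+ + [-> ->]]].
    rewrite !memP// => dm' en' eqde.
    have eqd := e1 _ _ dm en; rewrite eqde e1// in eqd.
    move: eqde; rewrite eqd => /eqP; rewrite eqn_pmul2l ?(dvdn_gt0 m0)//.
    by move=> /eqP ->.
  move=> k; rewrite memP//; apply/idP/allpairsP => [kmn|[[d e] /= [+ + ->]]].
    exists (gcdn k m, gcdn k n) => /=.
    rewrite !memP// !dvdn_gcdr; split => //.
    apply/eqP; rewrite eqn_dvd Gauss_dvd ?cop ?dvdn_gcdr// !dvdn_gcdl !andbT.
    rewrite muln_gcdl !muln_gcdr !dvdn_gcd kmn.
    by rewrite dvdn_mulr// dvdn_mulr// dvdn_mull.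
  by rewrite !memP//; exact: dvdn_mul.
rewrite big_allpairs_dep /sigma big_distrl /=.
by apply: eq_bigr => d _; rewrite big_distrr.
Qed.

Lemma sigma_prime (p : nat) : prime p -> sigma p = p.+1.
Proof.
move=> pp; have p0 := prime_gt0 pp.
have divp : perm_eq (divisors p) [:: 1%N; p].
  apply: uniq_perm; first exact: divisors_uniq.
    by rewrite /= inE andbT neq_ltn prime_gt1.
  move=> d; rewrite -dvdn_divisors// !inE; apply/idP/orP => [|[]/eqP -> //].
  by move=> /(primeP pp).2/orP.
by rewrite /sigma (perm_big _ divp) unlock /= addn0.
Qed.

Lemma infinite_natP (A : set nat) :
  infinite_set A <-> forall N, exists2 n, (N < n)%N & A n.
Proof.
split=> [infA N|unbA /finite_seqP[s As]].
  apply: contrapT => noA; apply: infA; apply: sub_finite_set (finite_II N.+1).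
  move=> n An /=; rewrite ltnS leqNgt; apply/negP => Nn; apply: noA.
  by exists n.
have [n sn An] := unbA (\max_(x <- s) x)%N.
move: An; rewrite As /= => ns.
by rewrite ltnNge (leq_bigmax_seq (F := id)) in sn.
Qed.

(** Up to [N] there are at least [N %/ M] elements of [A], and [N %/ M >= N / (2 * M)] once
    [N >= M]. So the liminf is at least [1 / (2 * M)]. *)
Lemma lower_density_gt0 (R : realType) (A : set nat) (M : nat) :
  (0 < M)%N -> (forall k : nat, A (k * M).+1) -> (0 < lower_density R A)%E.
Proof.
move=> M0 AM.
have count_aux q N : (q * M <= N)%N -> (q <= \sum_(1 <= k < N.+1) (k \in A))%N.
  elim: q N => [//|q IHq] N qMN.
  have qN : (q * M < N)%N by apply: leq_trans qMN; rewrite ltn_pmul2r.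
  (* The induction hypothesis counts up to [q * M]; the next index, [(q * M).+1], contributes one
     more. *)
  rewrite (big_cat_nat _ (n := (q * M).+1))//=; last by rewrite ltnS ltnW.
  by rewrite -addn1 leq_add ?IHq// big_ltn ?ltnS// mem_set ?leq_addr//.
have count N : (N %/ M <= \sum_(1 <= k < N.+1) (k \in A))%N.
  by apply: count_aux; exact: leq_trunc_div.
apply: (@lt_le_trans _ _ ((2 * M)%:R^-1)%:E).
  by rewrite lte_fin invr_gt0 ltr0n muln_gt0.
rewrite /lower_density -[limn_einf _]/(limf_einf _ \oo) limf_einfE.
(* The liminf is a supremum of infima over neighbourhoods of infinity; the tail [M <= N] is the one
   to use. *)
apply: le_trans; last first.
  apply: ereal_sup_ubound; exists [set N | (M <= N)%N]; last reflexivity.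
  by exists M.
apply: le_ereal_inf_tmp => _ [N /= MN <-]; rewrite lee_fin.
have N0 : (0 < N)%N by exact: leq_trans MN.
rewrite ler_pdivlMr ?ltr0n// mulrC ler_pdivrMr ?ltr0n ?muln_gt0//.
rewrite -natrM ler_nat.
apply: leq_trans (_ : (N %/ M * (2 * M) <= _)%N); last by rewrite leq_mul2r count orbT.
have := divn_eq N M; have := ltn_pmod N M0.
have : (1 <= N %/ M)%N by rewrite divn_gt0.
nia.
Qed.

(** The bound [l * a < p] keeps the prime [p] from dividing [l * a], so all three factors are
    pairwise coprime. *)
Lemma sigma_mul_prime (l a p : nat) : (0 < l)%N -> (0 < a)%N ->
  coprime l a -> prime p -> (l * a < p)%N ->
  sigma (l * (a * p))%N = (sigma l * (sigma a * p.+1))%N.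
Proof.
move=> l0 a0 la pp lap.
have la0 : (0 < l * a)%N by rewrite muln_gt0 l0.
have cop : coprime (l * a) p by rewrite coprime_sym prime_coprime// gtnNdvd.
by rewrite mulnA !sigmaM ?(prime_gt0 pp)// (sigma_prime pp) mulnA.
Qed.

Theorem theorem5 (R : realType) (m t : nat) (m_ge2 : (2 <= m)%N)
    (t_ge_m : (m <= t)%N) (dhl : DHLstar t m)
    (friends : exists (y : rat) (a : 'I_t -> nat),
      [/\ injective a, forall i, (0 < a i)%N &
          forall i, (sigma (a i))%:R / (a i)%:R = y]) :
  exists h : 'I_m -> nat,
    [/\ forall i, (0 < h i)%N,
        forall i j : 'I_m, (i < j)%N -> (h i < h j)%N &
        (0 < lower_density R [set l : nat | (0 < l)%N /\
           infinite_set [set n : nat | (0 < n)%N /\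
             forall i j : 'I_m,
               sigma (n + l * h i)%N = sigma (n + l * h j)%N]])%E].
Proof.
have [y [a [ainj a0 ay]]] := friends.
pose A := (\prod_i a i)%N.
have A0 : (0 < A)%N by exact: prodn_gt0.
have aA i : (a i %| A)%N by rewrite /A (bigD1 i)//= dvdn_mulr.
pose q i := (A %/ a i)%N.
have qa i : (q i * a i = A)%N by rewrite divnK.
have q0 i : (0 < q i)%N by rewrite divn_gt0// dvdn_leq.
have q_adm : admissible (fun i => (q i)%:Z) (fun=> -1).
  split=> [i|i j [/eqP]|[p pp /(_ 0)]]; first by rewrite ltz_nat.
    move=> /eqP qij; apply: ainj; apply/eqP.
    by rewrite -(eqn_pmul2l (q0 i)) qa qij qa.
  rewrite (eq_bigr (fun=> -1)) => [|i _]; last by rewrite mulr0 add0r.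
  rewrite prodr_const dvdzE abszX exp1n dvdn1 => /eqP /= p1.
  by rewrite p1 in pp.
have [s [sinj sinf]] := dhl _ _ q_adm.
pose j0 : 'I_m := Ordinal (ltnW m_ge2).
pose S := [set r : nat | forall j, prime_int ((q (s j))%:Z * r%:Z + -1)].
(* The hypothesis yields integers [r]; since [q (s j0) > 0], primality of the form at [j0] already
   forces [r > 0]. *)
have Sinf : infinite_set S.
  apply: contra_not sinf => /(finite_image Posz); apply: sub_finite_set.
  move=> r rP; have [p pp pE] := rP j0.
  have r0 : 0 < r by have := q0 (s j0); have := prime_gt0 pp; nia.
  by exists `|r|%N => [j|]; rewrite gtz0_abs.
(* As [a (s j) <= A], the truncated subtraction is exact, so these values are positive and
   distinct. *)
pose v := sort <=%O [seq (2 * A - a (s j))%N | j <- enum 'I_m].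
have sizev : size v = m by rewrite size_sort size_map size_enum_ord.
have vlt : sorted ltn v.
  rewrite Order.TotalTheory.sort_lt_sorted map_inj_in_uniq ?enum_uniq// => i j _ _.
  have := dvdn_leq A0 (aA (s i)); have := dvdn_leq A0 (aA (s j)) => ? ? ?.
  by apply/sinj/ainj; lia.
pose h (i : 'I_m) := nth 0%N v i.
have hP i : exists j, h i = (2 * A - a (s j))%N.
  have : h i \in v by rewrite mem_nth ?sizev.
  by rewrite mem_sort => /mapP[j _ ->]; exists j.
exists h; split => [i|i j ij|].
- by have [j ->] := hP i; have := dvdn_leq A0 (aA (s j)); lia.
- by apply: (sorted_ltn_nth ltn_trans) => //; rewrite inE sizev.
(* Both sides equal [y * A]; the rational equality is cross-multiplied to stay in [nat]. *)
have sq i j : (sigma (a i) * q i = sigma (a j) * q j)%N.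
  have aij : (sigma (a i) * a j = sigma (a j) * a i)%N.
    apply/eqP; rewrite -(eqr_nat rat) !natrM; apply/eqP.
    have ar k : (a k)%:R != 0 :> rat by rewrite pnatr_eq0 -lt0n.
    by apply/eqP; rewrite -eqr_div// !ay.
  have : (sigma (a i) * q i * A = sigma (a j) * q j * A)%N.
    rewrite -{1}(qa j) -(qa i).
    transitivity ((sigma (a i) * a j) * (q i * q j))%N; first ring.
    by rewrite aij; ring.
  by move/eqP; rewrite eqn_pmul2r// => /eqP.
apply: (@lower_density_gt0 R _ A A0) => k; split => //; set l := (k * A).+1.
apply/infinite_natP => N.
(* This bound on [r] gives [n > N], makes [r - 2] exact, and ensures [l * a (s j) < p] for every
   prime value [p] below. *)
have [r rN rS] := (infinite_natP S).1 Sinf (l * A + N + 3)%N.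
exists (l * A * (r - 2))%N; first by rewrite /l; nia.
split; first by rewrite !muln_gt0 A0/=; lia.
suff sigmaE i : sigma (l * A * (r - 2) + l * h i)%N =
    (sigma l * (sigma (a (s j0)) * q (s j0) * r))%N by move=> i j; rewrite !sigmaE.
have [j ->] := hP i; have [p pp pE] := rS j.
have pE' : (q (s j) * r = p.+1)%N by lia.
rewrite (sq (s j0) (s j)) -(mulnA (sigma _) (q _)) pE'.
have aleA := dvdn_leq A0 (aA (s j)).
rewrite -sigma_mul_prime//.
- congr sigma; rewrite -mulnA -mulnDr; congr (l * _)%N.
  have : (a (s j) * p + a (s j) = A * r)%N.
    by rewrite addnC -mulnS -pE' mulnA (mulnC (a _)) qa.
  by have : (A * 3 <= A * r)%N; [rewrite leq_mul2l; lia|rewrite mulnBr; lia].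
- by rewrite (coprime_dvdr (aA _))// coprime_sym /coprime /l -addn1 gcdnMDl gcdn1.
- have := q0 (s j); nia.
Qed.
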